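(* Let $r,k$ be positive integers, let $T=(\mathbb{C}^\times)^r$, and let $V$ be a $k$-dimensional complex representation of $T$ with basis $x_1,\dots,x_k$ and weights $w_1,\dots,w_k\in\mathbb{Z}^r$, so that $t\cdot x_i=t_1^{w_{i1}}\cdots t_r^{w_{ir}}x_i$ for all $t=(t_1,\dots,t_r)\in T$. For every positive integer $n$ let $$R_n=\bigoplus_{d=0}^\infty R_n^{(d)},\qquad R_n^{(d)}=\big((\operatorname{Sym}^d V)^{\otimes n}\big)^T .$$ Let $d_0$ be a positive integer such that for every positive integer $n$ the $\mathbb{C}$-algebra $R_n$ is generated by its elements of degrees $\le d_0$. For every positive integer $n$ let $$P_n=\operatorname{Sym}\Big(\bigoplus_{d=0}^{d_0}R_n^{(d)}\Big),$$ and let $\mathscr{I}_n$ be the kernel of the natural surjection $P_n\to R_n$. Then there exists a positive integer $d_1$ such that, for all positive integers $n$, $\mathscr{I}_n$ is generated as a $P_n$-module (that is, as an ideal of $P_n$) by homogeneous elements of multi-homogeneous degree $\le d_1$. (The integer $d_1$ does not depend on $n$.)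
   Context: $\operatorname{Sym}^d V$ is the space of homogeneous polynomials of degree $d$ in $\mathbb{C}[x_1,\dots,x_k]=\operatorname{Sym} V$, with the induced action of $T$. The multi-homogeneous polynomial ring is the graded ring $S^{\boxtimes n}=\bigoplus_{d\ge 0}(\operatorname{Sym}^d V)^{\otimes n}$, where the $n$-fold tensor products are over $\mathbb{C}$, the multiplication is factorwise, $(f_1\otimes\cdots\otimes f_n)(g_1\otimes\cdots\otimes g_n)=f_1g_1\otimes\cdots\otimes f_ng_n$, and $(\operatorname{Sym}^d V)^{\otimes n}$ is placed in degree $d$. The torus $T$ acts diagonally: $t\cdot(f_1\otimes\cdots\otimes f_n)=(t\cdot f_1)\otimes\cdots\otimes(t\cdot f_n)$. Thus $R_n=(S^{\boxtimes n})^T$ is a graded subring of $S^{\boxtimes n}$. As a vector space, $R_n^{(d)}$ is spanned by the invariant multi-homogeneous monomials of degree $d$, i.e. the tensors $f_1\otimes\cdots\otimes f_n$ with each $f_i$ a monomial of degree $d$ in $x_1,\dots,x_k$, such that the sum of the weights of all $nd$ variables occurring (with multiplicity) is $0\in\mathbb{Z}^r$. $P_n$ is the symmetric algebra over $\mathbb{C}$ of the vector space $\bigoplus_{d=0}^{d_0}R_n^{(d)}$. The natural map $P_n\to R_n$ is the $\mathbb{C}$-algebra homomorphism extending the inclusion $\bigoplus_{d=0}^{d_0}R_n^{(d)}\subset R_n$; it is surjective by the choice of $d_0$. The multi-homogeneous degree on $P_n$ is the grading in which the generators from $R_n^{(d)}$ have degree $d$ (so a product of generators of degrees $e_1,\dots,e_p$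 has degree $e_1+\cdots+e_p$); the map $P_n\to R_n$ is then a graded homomorphism and $\mathscr{I}_n$ is a homogeneous ideal. *)

(* Defs.v *)
From HB Require Import structures.
From mathcomp Require Import all_boot all_order all_algebra.
From mathcomp Require Import ring_quotient generic_quotient.
From mathcomp Require Import boolp.
From mathcomp Require finmap monalg.

Set Implicit Arguments.
Unset Strict Implicit.
Unset Printing Implicit Defensive.

Import GRing.Theory.
Local Open Scope ring_scope.
Local Open Scope quotient_scope.

(* [lin_span G v]: v is a finite K-linear combination of elements of G. *)
Definition lin_span (K : nzRingType) (V : lmodType K) (G : V -> Prop) (v : V) :
    Prop :=
  exists (m : nat) (a : 'I_m -> K) (g : 'I_m -> V),
    (forall i, G (g i)) /\ v = \sum_i a i *: g i.

(* The ideal generated by G, that is, the A-submodule of A that G spans. *)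
Definition ideal_span (A : comNzRingType) (G : A -> Prop) : A -> Prop :=
  @lin_span A A^o G.

Lemma lin_span_gen (K : nzRingType) (V : lmodType K) (G : V -> Prop) v :
  G v -> lin_span G v.
Proof.
by move=> Gv; exists 1, (fun=> 1), (fun=> v); rewrite big_ord1 scale1r.
Qed.

Lemma lin_span0 (K : nzRingType) (V : lmodType K) (G : V -> Prop) :
  lin_span G 0.
Proof.
by exists 0, (fun=> 0), (fun=> 0); split=> [[]//|]; rewrite big_ord0.
Qed.

Lemma lin_spanZD (K : nzRingType) (V : lmodType K) (G : V -> Prop) c u v :
  lin_span G u -> lin_span G v -> lin_span G (c *: u + v).
Proof.
move=> [m [a [g [Gg ->]]]] [l [b [h [Gh ->]]]].
exists (m + l)%N.
exists (fun i => match split i with inl x => c * a x | inr y => b y end).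
exists (fun i => match split i with inl x => g x | inr y => h y end).
split=> [i|]; first by case: (split i).
rewrite big_split_ord scaler_sumr /=.
by congr (_ + _); apply: eq_bigr => i _;
  rewrite ?(unsplitK (inl _)) ?(unsplitK (inr _)) ?scalerA.
Qed.


Section QuotAlg.
Context (K : comNzRingType) (F : comAlgType K) (I : idealr F).

Definition quot_alg : Type := {ideal_quot I}.
HB.instance Definition _ := GRing.ComNzRing.on quot_alg.
HB.instance Definition _ := @NzRingQuotient.on quot_alg.

Local Notation proj := (\pi_quot_alg : {rmorphism F -> quot_alg}).

Definition quot_scale (c : K) (q : quot_alg) : quot_alg := proj c%:A * q.

Fact quot_scaleA a b v : quot_scale a (quot_scale b v) = quot_scale (a * b) v.
Proof. by rewrite /quot_scale mulrA -rmorphM -(rmorphM (in_alg F)). Qed.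
Fact quot_scale1 : left_id 1 quot_scale.
Proof. by move=> v; rewrite /quot_scale scale1r rmorph1 mul1r. Qed.
Fact quot_scaleDr : right_distributive quot_scale +%R.
Proof. by move=> c u v; rewrite /quot_scale mulrDr. Qed.
Fact quot_scaleDl v : {morph quot_scale^~ v : a b / a + b}.
Proof. by move=> a b; rewrite /quot_scale scalerDl rmorphD mulrDl. Qed.
HB.instance Definition _ := GRing.Zmodule_isLmodule.Build K quot_alg
  quot_scaleA quot_scale1 quot_scaleDr quot_scaleDl.

Fact quot_scaleAl (c : K) (u v : quot_alg) : c *: (u * v) = c *: u * v.
Proof. exact: mulrA. Qed.
HB.instance Definition _ := GRing.Lmodule_isLalgebra.Build K quot_alg
  quot_scaleAl.
HB.instance Definition _ := GRing.Lalgebra_isComAlgebra.Build K quot_alg.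

Fact quot_projZ c x : proj (c *: x) = c *: proj x.
Proof. by rewrite -mulr_algl rmorphM. Qed.

Lemma quot_alg_spec : exists (Q : comAlgType K) (pr : {lrmorphism F -> Q}),
  (forall q, exists x, pr x = q) /\ (forall x, (pr x == 0) = (x \in I)).
Proof.
pose lin := GRing.isScalable.Build K F quot_alg *:%R \pi_quot_alg quot_projZ.
pose pr : {lrmorphism F -> quot_alg} := HB.pack (\pi_quot_alg) lin.
exists quot_alg, pr; split=> [q|x]; first by exists (repr q); exact: reprK.
by rewrite -[x in RHS]subr0 Quotient.idealrBE (rmorph0 proj).
Qed.
End QuotAlg.

(* Universal property of the symmetric algebra of W, with its canonical map. *)
Definition is_symmetric_algebra (K : comNzRingType) (W : lmodType K)
    (P : comAlgType K) (iota : {linear W -> P}) : Prop :=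
  forall (A : comAlgType K) (f : {linear W -> A}),
    exists g : {lrmorphism P -> A}, (forall u, g (iota u) = f u) /\
      forall h : {lrmorphism P -> A}, (forall u, h (iota u) = f u) -> h =1 g.

(* Existence of the symmetric algebra, as the quotient of the polynomial ring
   {malg K[{cmonom W}]}, with one variable for each element of W, by the ideal
   expressing that W is embedded linearly. *)
Module SymAlg.
Import finmap monalg.
Local Notation "1" := (@mone _) : monom_scope.
Local Notation "x * y" := (mmul x y) : monom_scope.
Section SymAlg.
Context (K : comNzRingType) (W : lmodType K).

Local Notation F := {malg K[{cmonom W}]}.

(* Sealed: comparing two monomials by unfolding them does not terminate in
   practice. *)
Fact term_subdef :
  {t : K -> W -> F | forall c u, t c u = << c *g ucm u >>}.
Proof. by exists (fun c u => << c *g ucm u >>). Qed.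
Definition term : K -> W -> F := sval term_subdef.
Lemma termE c u : term c u = << c *g ucm u >>.
Proof. exact: (svalP term_subdef). Qed.

Definition relation (x : F) : Prop :=
  exists (a : K) (u v : W), x = term 1 (a *: u + v) - term a u - term 1 v.

Definition relation_ideal : {pred F} := fun x => `[< ideal_span relation x >].

Section Eval.
Context (A : comAlgType K) (f : W -> A).
Definition meval (m : {cmonom W}) : A := \prod_(u <- finsupp m) f u ^+ m u.

Lemma mevalEw (m : {cmonom W}) (d : {fset W}) : (finsupp m `<=` d)%fset ->
  meval m = \prod_(u <- d) f u ^+ m u.
Proof.
move=> le; rewrite /meval (big_fset_incl _ le) //= => u _.
by rewrite -cmE_neq0 negbK => /eqP ->.
Qed.

Lemma meval_is_mmorph : mmorphism meval.
Proof.
split=> [m1 m2|]; last by rewrite /meval mdom1 big_seq_fset0.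
rewrite /= (@mevalEw m1 (finsupp m1 `|` finsupp m2)%fset) ?fsubsetUl //.
rewrite (@mevalEw m2 (finsupp m1 `|` finsupp m2)%fset) ?fsubsetUr //.
rewrite /meval mdomD -big_split /=; apply: eq_bigr => u _.
by rewrite cmM exprD.
Qed.

HB.instance Definition _ := isMultiplicative.Build {cmonom W} A meval
  meval_is_mmorph.

Definition eval : F -> A := mmap (in_alg A) meval.
HB.instance Definition _ := GRing.RMorphism.on eval.

Lemma evalB : {morph eval : x y / x - y}.
Proof. exact: rmorphB. Qed.

Lemma evalM : {morph eval : x y / x * y}.
Proof. exact: rmorphM. Qed.

Lemma eval1 : eval 1 = 1.
Proof. exact: rmorph1. Qed.

Lemma eval_is_scalable : scalable eval.
Proof. by move=> c x; rewrite /eval mmapZ /= mulr_algl. Qed.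
HB.instance Definition _ := GRing.isScalable.Build K F A *:%R eval
  eval_is_scalable.

Lemma eval_term c u : eval (term c u) = c *: f u.
Proof.
by rewrite termE /eval mmapU /= /meval mdomU big_seq_fset1 cmUU mulr_algl.
Qed.
End Eval.

Lemma eval_relation (A : comAlgType K) (f : {linear W -> A}) x :
  ideal_span relation x -> eval f x = 0.
Proof.
move=> [m [a [g [Gg ->]]]]; rewrite rmorph_sum big1 // => i _.
suff fg0 : eval f (g i) = 0.
  by apply: etrans (evalM f (a i) (g i)) _; rewrite fg0 mulr0.
have [c [u [v ->]]] := Gg i; rewrite 2!evalB !eval_term !scale1r linearP.
by rewrite [_ *: _ + _]addrC addrK subrr.
Qed.

Lemma relation_idealP : idealr_closed relation_ideal.
Proof.
split.
- exact/asboolP/lin_span0.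
- apply/asboolP => /(@eval_relation K^o \0) /eqP.
  by rewrite rmorph1 oner_eq0.
- by move=> a u v /asboolP Iu /asboolP Iv; exact/asboolP/lin_spanZD.
Qed.
HB.instance Definition _ :=
  isIdealr.Build F relation_ideal relation_idealP.


Lemma cmonom_ind (Q : {cmonom W} -> Prop) :
  Q 1%M -> (forall u m, Q m -> Q (ucm u * m)%M) -> forall m, Q m.
Proof.
move=> Q1 QM m; have [n] := ubnP (mdeg m); elim: n m => // n IHn m.
rewrite ltnS => lemn; have [d0|] := eqVneq (finsupp m) fset0.
  by rewrite [m]mdeg_eq0I // mdegE d0 big_seq_fset0.
case/fset0Pn => u um.
have mE : m = (ucm u * divcm m (ucm u))%M.
  apply/eqP/cmP => v; rewrite cmM divcmE cmU subnKC //.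
  by case: eqVneq => // <-; rewrite lt0n cmE_neq0.
rewrite mE; apply/QM/IHn; move: lemn; rewrite {1}mE mdegM mdegU add1n.
exact.
Qed.

Lemma free_alg_ext (A : comAlgType K) (g h : {lrmorphism F -> A}) :
  (forall u, g (term 1 u) = h (term 1 u)) -> g =1 h.
Proof.
move=> gh x; rewrite [x]monalgE !raddf_sum; apply: eq_bigr => m _.
move: (x@_m) => c {x}; elim/cmonom_ind: m => [|u m IHm].
  have -> : << c *g 1%M >> = c *: 1 :> F by rewrite -mul_malgC mulr1.
  have E (k : {lrmorphism F -> A}) : k (c *: 1) = c *: 1.
    by rewrite -[in RHS](rmorph1 k); exact: linearZ.
  exact: etrans (E g) (esym (E h)).
have E (k : {lrmorphism F -> A}) :
    k << c *g (ucm u * m)%M >> = k (term 1 u) * k << c *g m >>.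
  rewrite -[RHS](rmorphM k); congr (k _).
  by rewrite termE malgM_def fgmulUU mul1r.
by apply: etrans (E g) (etrans _ (esym (E h))); rewrite IHm gh.
Qed.

Theorem exists_symmetric_algebra :
  exists (P : comAlgType K) (iota : {linear W -> P}), is_symmetric_algebra iota.
Proof.
have [P [pr [pr_surj pr_ker]]] := @quot_alg_spec K F relation_ideal.
have prZ c u : pr (term c u) = c *: pr (term 1 u).
  have -> : term c u = c%:MP * term 1 u.
    by rewrite !termE malgM_def fgmulUU mulr1 mul1m.
  have -> : c%:MP * term 1 u = c *: term 1 u :> F by rewrite mul_malgC.
  exact: linearZ.
have iota_lin : linear (fun u => pr (term 1 u)).
  move=> a u v; apply/eqP; rewrite -subr_eq0 opprD addrA -prZ -!rmorphB pr_ker.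
  by apply/asboolP/lin_span_gen; exists a, u, v.
pose lin := GRing.isLinear.Build K W P *:%R _ iota_lin.
pose iota : {linear W -> P} := HB.pack (fun u => pr (term 1 u)) lin.
exists P, iota => A f.
pose s q := sval (cid (pr_surj q)).
have sK q : pr (s q) = q by rewrite /s; case: cid.
have lift_pr x : eval f (s (pr x)) = eval f x.
  apply/eqP; rewrite -subr_eq0 -evalB; apply/eqP/eval_relation/asboolP.
  have E : pr (s (pr x) - x) = 0 by rewrite [LHS](rmorphB pr) [X in X - _]sK subrr.
  by have := pr_ker (s (pr x) - x); rewrite E eqxx => /esym.
pose g q := eval f (s q).
have g_add : zmod_morphism g.
  by move=> p q; rewrite -[p]sK -[q]sK -rmorphB /g !lift_pr evalB.
have g_mul : monoid_morphism g.
  split=> [|p q]; first by rewrite -(rmorph1 pr) /g lift_pr eval1.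
  by rewrite -[p]sK -[q]sK -rmorphM /g !lift_pr evalM.
have g_scal : scalable g.
  by move=> c p; rewrite -[p]sK -linearZ /g !lift_pr; exact: eval_is_scalable.
pose m1 := GRing.isZmodMorphism.Build P A g g_add.
pose m2 := GRing.isMonoidMorphism.Build P A g g_mul.
pose m3 := GRing.isScalable.Build K P A *:%R g g_scal.
pose gl : {lrmorphism P -> A} := HB.pack g m1 m2 m3.
have gl_iota u : gl (iota u) = f u.
  by rewrite /= /g lift_pr eval_term scale1r.
exists gl; split=> // h h_iota q; rewrite -[q]sK.
pose hp : {lrmorphism F -> A} := h \o pr.
pose gp : {lrmorphism F -> A} := gl \o pr.
apply: (free_alg_ext (g := hp) (h := gp)) => u.
by rewrite /= -/(iota u) h_iota -gl_iota.
Qed.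

End SymAlg.
End SymAlg.

(* [sym_alg W] is an algebra satisfying the universal property; it is taken
   from the existence theorem, so that it does not unfold to a quotient. *)
Section Sym.
Context (K : comNzRingType) (W : lmodType K).

Definition sym_alg : comAlgType K :=
  sval (cid (SymAlg.exists_symmetric_algebra W)).

Definition sym_in : {linear W -> sym_alg} :=
  sval (cid (svalP (cid (SymAlg.exists_symmetric_algebra W)))).

Lemma sym_algP : is_symmetric_algebra sym_in.
Proof. exact: svalP (cid (svalP (cid _))). Qed.

Definition sym_lift (A : comAlgType K) (f : {linear W -> A}) :
  {lrmorphism sym_alg -> A} := sval (cid (sym_algP f)).

Lemma sym_lift_in (A : comAlgType K) (f : {linear W -> A}) u :
  sym_lift f (sym_in u) = f u.
Proof. by rewrite /sym_lift; case: cid => g []. Qed.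

Lemma sym_lift_unique (A : comAlgType K) (f : {linear W -> A})
    (h : {lrmorphism sym_alg -> A}) :
  (forall u, h (sym_in u) = f u) -> h =1 sym_lift f.
Proof. by have [_ gU] := svalP (cid (sym_algP f)); exact: gU. Qed.

End Sym.

(* f belongs to the K-subalgebra of A generated by G. *)
Definition alg_gen (K : nzRingType) (A : algType K) (G : A -> Prop) (f : A) :
    Prop :=
  forall B : {pred A},
    GRing.subalg_closed B -> (forall g, G g -> g \in B) -> f \in B.

From mathcomp Require Import mpoly.

Lemma comp_mpolyA (R : comNzRingType) (l m n : nat) (p : {mpoly R[l]})
    (u : l.-tuple {mpoly R[m]}) (v : m.-tuple {mpoly R[n]}) :
  (p \mPo u) \mPo v = p \mPo [tuple tnth u i \mPo v | i < l].
Proof.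
rewrite [p \mPo u]comp_mpolyEX [RHS]comp_mpolyEX raddf_sum /=.
apply: eq_bigr => e _; rewrite comp_mpolyZ !comp_mpolyX rmorph_prod /=.
by congr (_ *: _); apply: eq_bigr => i _; rewrite tnth_mktuple -rmorphXn.
Qed.

Section TorusInvariants.
Context (C : fieldType) (r k : nat) (w : 'M[int]_(k, r)).

Definition in_torus (t : 'I_r -> C) : Prop := forall j, t j != 0.

(* The weight w_i of x_i, as a character of the torus. *)
Definition weight_char (t : 'I_r -> C) (i : 'I_k) : C :=
  \prod_(j < r) t j ^ w i j.

(* Sym V = C[x_1, ..., x_k] is {mpoly C[k]}. *)
Definition sym_act (t : 'I_r -> C) (f : {mpoly C[k]}) : {mpoly C[k]} :=
  f \mPo [tuple weight_char t i *: 'X_i | i < k].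

Section Factors.
Context (n : nat).
(* (Sym V)^{(x) n} is realised as the polynomial ring in the n * k variables
   x_(a, i) = 'X_(mxvec_index a i), the a-th tensor factor being the polynomial
   ring in x_(a, 1), ..., x_(a, k); products of polynomials are the factorwise
   products (tensorM), and tensors of monomials are the monomials (tensorX). *)
Local Notation A := {mpoly C[n * k]}.

Definition tensor_in (a : 'I_n) (f : {mpoly C[k]}) : A :=
  f \mPo [tuple 'X_(mxvec_index a i) | i < k].

Definition tensor (f : 'I_n -> {mpoly C[k]}) : A :=
  \prod_(a < n) tensor_in a (f a).

(* The diagonal action; see tensor_act_tensor. *)
Definition tensor_act (t : 'I_r -> C) (F : A) : A :=
  F \mPo [tuple mxvec (\matrix_(a < n, i < k)
             (weight_char t i *: 'X_(mxvec_index a i))) 0 j | j < n * k].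

Lemma tensorM f g : tensor (fun a => f a * g a) = tensor f * tensor g.
Proof.
by rewrite /tensor -big_split; apply: eq_bigr => a _; exact: rmorphM.
Qed.

Lemma tensorX (m : 'I_n -> 'X_{1..k}) :
  tensor (fun a => 'X_[m a]) =
  'X_[[multinom mxvec (\matrix_(a, i) m a i) ord0 j | j < n * k]].
Proof.
rewrite mpolyXE_id (reindex _ (curry_mxvec_bij n k)) /=.
set M := [multinom _ | _ < _].
transitivity (\prod_(a < n) \prod_(i < k)
    ('X_(mxvec_index a i) : A) ^+ M (mxvec_index a i)); last first.
  by rewrite pair_bigA; apply: eq_bigr => -[].
apply: eq_bigr => a _; rewrite /tensor_in comp_mpolyX; apply: eq_bigr => i _.
by rewrite tnth_mktuple mnmE mxvecE mxE.
Qed.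

Lemma tensor_act_tensor t f :
  tensor_act t (tensor f) = tensor (fun a => sym_act t (f a)).
Proof.
rewrite /tensor_act /tensor rmorph_prod; apply: eq_bigr => a _ /=.
rewrite /tensor_in /sym_act !comp_mpolyA; congr (_ \mPo _).
apply: eq_from_tnth => i; rewrite !tnth_mktuple comp_mpolyZ.
by rewrite !comp_mpolyXU -!tnth_nth !tnth_mktuple mxvecE mxE.
Qed.

(* (Sym^d V)^{(x) n}, the degree d part of the multi-homogeneous ring. *)
Definition segre_deg (d : nat) : A -> Prop :=
  lin_span (fun F => exists f : 'I_n -> {mpoly C[k]},
    (forall a, f a \is d.-homog) /\ F = tensor f).

(* R_n^(d). *)
Definition inv_deg (d : nat) (F : A) : Prop :=
  segre_deg d F /\ forall t, in_torus t -> tensor_act t F = F.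

(* The sum of the R_n^(d) for d <= D, inside the polynomial ring; it is direct
   because R_n^(d) is homogeneous of total degree n * d, with n > 0. *)
Definition inv_upto (D : nat) : {pred A} := fun F =>
  `[< exists g : 'I_D.+1 -> A,
        (forall d : 'I_D.+1, inv_deg d (g d)) /\ F = \sum_d g d >].

(* R_n. *)
Definition inv_ring (F : A) : Prop := exists D, F \in inv_upto D.

Lemma inv_degZD d c F G :
  inv_deg d F -> inv_deg d G -> inv_deg d (c *: F + G).
Proof.
move=> [sF iF] [sG iG]; split=> [|t Tt]; first exact: lin_spanZD.
by rewrite -[in RHS](iF t Tt) -[in RHS](iG t Tt); exact: linearP.
Qed.

Lemma inv_deg0 d : inv_deg d 0.
Proof. by split=> [|t _]; [exact: lin_span0 | exact: raddf0]. Qed.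

Lemma inv_upto_submod D : GRing.submod_closed (inv_upto D).
Proof.
split=> [|c F G /asboolP[f [fP ->]] /asboolP[g [gP ->]]]; apply/asboolP.
  by exists (fun=> 0); split=> [d|]; [exact: inv_deg0 | rewrite big1].
exists (fun d => c *: f d + g d); split=> [d|]; first exact: inv_degZD.
by rewrite big_split scaler_sumr.
Qed.
HB.instance Definition _ D :=
  GRing.isSubmodClosed.Build C A (inv_upto D) (inv_upto_submod D).

Definition inv_space (D : nat) : Type := {F : A | F \in inv_upto D}.
HB.instance Definition _ D := SubChoice.on (inv_space D).
HB.instance Definition _ D := [SubChoice_isSubLmodule of inv_space D by <:].

Definition generated_upto (D : nat) : Prop :=
  forall F, inv_ring F ->
    alg_gen (fun G => exists d, (d <= D)%N /\ inv_deg d G) F.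

(* P_n. *)
Definition pres_alg (D : nat) : comAlgType C := sym_alg (inv_space D).

(* The natural map from P_n to R_n, followed by the inclusion of R_n in the
   polynomial ring, which does not change the kernel. *)
Definition pres_map (D : nat) : {lrmorphism pres_alg D -> A} :=
  sym_lift (\val : {linear inv_space D -> A}).

Definition pres_ideal (D : nat) (p : pres_alg D) : Prop := pres_map D p = 0.

(* Multi-homogeneous of degree e: a combination of products of generators
   taken from the R_n^(d_j), with the d_j summing to e. *)
Definition multihomog (D e : nat) : pres_alg D -> Prop :=
  lin_span (fun p => exists (m : nat) (d : 'I_m -> nat)
    (u : 'I_m -> inv_space D),
    [/\ forall j, (d j <= D)%N /\ inv_deg (d j) (\val (u j)),
        (\sum_j d j = e)%N & p = \prod_j sym_in _ (u j)]).

Lemma inv_deg_upto (D d : nat) F : (d <= D)%N -> inv_deg d F -> F \in inv_upto D.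
Proof.
move=> leDd dF; apply/asboolP; exists (fun e => if e == d :> nat then F else 0).
split=> [e|]; first by case: eqP => [->|_] //; exact: inv_deg0.
rewrite -big_mkcond (big_pred1 (Ordinal (leDd : (d < D.+1)%N))) //.
Qed.

Lemma pres_map_onto (D : nat) : generated_upto D ->
  forall F, inv_ring F -> exists p, pres_map D p = F.
Proof.
move=> genD F /genD/(_ (fun G => `[< exists p, pres_map D p = G >])) H.
apply/asboolP/H => [|G [d [leDd dG]]]; last first.
  apply/asboolP; exists (sym_in _ (Sub G (inv_deg_upto leDd dG))).
  by rewrite [LHS]sym_lift_in.
split=> [|c _ _ /asboolP[p <-] /asboolP[q <-]|_ _ /asboolP[p <-] /asboolP[q <-]].
- by apply/asboolP; exists 1; exact: rmorph1.
- by apply/asboolP; exists (c *: p + q); exact: linearP.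
- by apply/asboolP; exists (p * q); exact: rmorphM.
Qed.

End Factors.
End TorusInvariants.

(* Main.v *)
From HB Require Import structures.
Require Import Defs.
From mathcomp Require Import all_boot all_order all_algebra.
From mathcomp Require Import mpoly complex reals.
From mathcomp Require Import boolp zify.

Set Implicit Arguments.
Unset Strict Implicit.
Unset Printing Implicit Defensive.

Import Order.TTheory GRing.Theory Num.Theory.
Local Open Scope ring_scope.

(** A monomial of (Sym V)^{(x) n} is an n by k matrix of natural numbers; it is
    an invariant of degree d when its rows all sum to d and its total weight
    vanishes. Such matrices form a monoid M_n, written additively. R_n is the
    monoid algebra of M_n, and the kernel of P_n -> R_n is spanned by the
    differences of two products of generators with the same image m in M_n
    ([gen_prod_spanned], [monomial_relation]).

    By induction on the degree D of m, two factorisations s and t of m are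
    congruent modulo low-degree relations as soon as they can be linked by
    factorisations in which consecutive ones share a factor of positive degree:
    what is left after removing that factor has smaller degree. So let g be a
    factor in s and h a factor in t. It is enough to find f and f' in M_n, of
    positive degree, such that g + f, f + f' and f' + h are at most m: a
    difference of comparable elements of M_n is again in M_n, hence a sum of
    generators, and so m has factorisations through g + f, through f + f' and
    through f' + h ([fibre_connected]). The point is that f and f' exist once D
    exceeds a bound that does not depend on n ([compatible_parts]).

    They are found by halving. Half of a matrix with even row sums is a half-
    integral matrix; rounding it in a row means splitting the set of odd
    entries of the row into two halves and choosing which one is rounded up.
    The two choices change the weight by opposite amounts, and the number of
    possible sets of odd entries is bounded in terms of k. When the rows with
    the same odd set alternate between the two choices, the errors cancel up
    to a bound C that does not depend on n. Two matrices A, B <= m can be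
    halved together so that their halves add up to at most m
    ([joint_halving]); applied to A <= m - g and B <= m - h, this makes room
    for f below half of A and for f' below half of B. Halving again and again
    a matrix whose weight is in the box [-C, C]^r gives a decreasing chain of
    matrices with weights in that box; when the chain is longer than the
    number of points of the box, two of its members have the same weight, and
    their difference is an element of M_n of positive degree
    ([zero_weight_part]). To be able to halve that often one starts from an
    element of M_n below m - g whose degree is a multiple of a large power of
    2: a sum of consecutive factors of m - g ([partial_sum_part]). *)

(** * Splitting sets and choosing signs *)

Lemma exists_subset_card (T : finType) (A : {set T}) c :
  (c <= #|A|)%N -> exists2 B : {set T}, B \subset A & #|B| = c.
Proof.
rewrite -bin_gt0 -cards_draws card_gt0 => /set0Pn[B].
by rewrite inE => /andP[sBA /eqP cB]; exists B.
Qed.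

(** Each of X and Y is cut into two halves so that neither the two first halves
    nor the two second halves meet: on the intersection of X and Y the cuts are
    opposite, and parity leaves enough room outside it to balance them. *)
Lemma disjoint_halves (T : finType) (X Y : {set T}) :
    ~~ odd #|X| -> ~~ odd #|Y| -> exists UV : {set T} * {set T},
  [/\ UV.1 \subset X /\ UV.2 \subset Y, (#|UV.1|.*2 = #|X|)%N,
      (#|UV.2|.*2 = #|Y|)%N, [disjoint UV.1 & UV.2]
      & [disjoint X :\: UV.1 & Y :\: UV.2]].
Proof.
move=> eX eY; pose I := X :&: Y.
have := cardsID Y X; have := cardsID X Y; rewrite setIC -/I => cY cX.
have [U1 sU1 cU1] : exists2 B : {set T}, B \subset I & #|B| = #|I|./2.
  by apply: exists_subset_card; lia.
have := cardsID U1 I; rewrite (setIidPr sU1) => cI.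
have [U2 sU2 cU2] : exists2 B : {set T},
    B \subset X :\: Y & #|B| = (#|X|./2 - #|U1|)%N.
  by apply: exists_subset_card; lia.
have [V2 sV2 cV2] : exists2 B : {set T},
    B \subset Y :\: X & #|B| = (#|Y|./2 - #|I :\: U1|)%N.
  by apply: exists_subset_card; lia.
have disjU : U1 :&: U2 = set0.
  apply/setP => x; rewrite in_setI in_set0; apply/negbTE/negP.
  move=> /andP[/(subsetP sU1) + /(subsetP sU2)].
  by rewrite !inE => /andP[_ ->].
have disjV : (I :\: U1) :&: V2 = set0.
  apply/setP => x; rewrite in_setI in_set0; apply/negbTE/negP.
  move=> /andP[+ /(subsetP sV2)].
  by rewrite !inE => /and3P[_ -> _].
exists (U1 :|: U2, (I :\: U1) :|: V2); split => /=.
- split; apply/subsetP => x; rewrite !inE.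
    by case/orP => [/(subsetP sU1)|/(subsetP sU2)]; rewrite !inE => /andP[].
  by case/orP => [/and3P[]//|/(subsetP sV2)]; rewrite !inE => /andP[].
- by rewrite cardsU disjU cards0 cU2; lia.
- by rewrite cardsU disjV cards0 cV2; lia.
- rewrite -setI_eq0; apply/eqP/setP => x; rewrite !inE.
  have /implyP := subsetP sU1 x; have /implyP := subsetP sU2 x.
  have /implyP := subsetP sV2 x; rewrite !inE.
  by do ![case: (x \in _)].
- rewrite -setI_eq0; apply/eqP/setP => x; rewrite !inE.
  have /implyP := subsetP sU1 x; have /implyP := subsetP sU2 x.
  have /implyP := subsetP sV2 x; rewrite !inE.
  by do ![case: (x \in _)].
Qed.

(** Elements with the same label receive alternating signs, so the signs of each
    label sum to 0 or 1, however many elements carry it. *)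
Lemma alternating_signs (I : eqType) (T : finType) (tau : I -> T) (s : seq I) :
  uniq s -> exists sg : I -> bool, forall t,
    0 <= (\sum_(a <- s | tau a == t) (-1) ^+ sg a : int) <= 1.
Proof.
elim: s => [_|a s IHs /= /andP[nas us]].
  by exists (fun=> true) => t; rewrite big_nil.
have [sg sgP] := IHs us.
pose S t : int := \sum_(b <- s | tau b == t) (-1) ^+ sg b.
exists (fun b => if b == a then S (tau a) == 1 else sg b) => t.
rewrite big_cons eqxx.
have -> : \sum_(b <- s | tau b == t)
    (-1) ^+ (if b == a then S (tau a) == 1 else sg b) = S t.
  rewrite big_seq_cond [RHS]big_seq_cond; apply: eq_bigr => b /andP[bs _].
  by case: eqP => // ab; move: nas; rewrite -ab bs.
have := sgP t; rewrite -/(S t); case: (tau a =P t) => [->|//].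
by have [->|] := eqVneq (S t) 1; rewrite ?expr0 ?expr1; lia.
Qed.

(** The bound depends on the labels only, and not on the number of elements. *)
Lemma balanced_signs (I T : finType) (tau : I -> T) :
  exists sg : I -> bool, forall delta : T -> int,
    `|\sum_a (-1) ^+ sg a * delta (tau a)| <= \sum_t `|delta t|.
Proof.
have [sg sgP] := alternating_signs tau (index_enum_uniq I).
exists sg => delta; rewrite (partition_big tau xpredT) //=.
apply: le_trans (ler_norm_sum _ _ _) _; apply: ler_sum => t _.
rewrite (eq_bigr (fun a => (-1) ^+ sg a * delta t)) => [|a /eqP <- //].
rewrite -mulr_suml normrM ler_piMl //.
by case/andP: (sgP t) => ge0 le1; rewrite ger0_norm.
Qed.

(** * Monomials as matrices *)

Section Monomials.
Context (r k : nat) (w : 'M[int]_(k, r)) (n : nat).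
Implicit Types (m g A B : 'X_{1..n * k}) (a : 'I_n) (i : 'I_k) (j : 'I_r).

Lemma mon_ind (P : 'I_(n * k) -> Prop) :
  (forall a i, P (mxvec_index a i)) -> forall l, P l.
Proof. by move=> H l; case/mxvec_indexP: l. Qed.

Definition mon_of (f : 'I_n -> 'I_k -> nat) : 'X_{1..n * k} :=
  [multinom mxvec (\matrix_(a, i) f a i) ord0 j | j < n * k].

Lemma mon_ofE f a i : mon_of f (mxvec_index a i) = f a i.
Proof. by rewrite mnmE mxvecE mxE. Qed.

Lemma mon_lepP m g :
  reflect (forall a i, (m (mxvec_index a i) <= g (mxvec_index a i))%N)
          (m <= g)%MM.
Proof.
by apply: (iffP mnm_lepP) => [le a i|]; [exact: le | exact: mon_ind].
Qed.

Definition row_deg m a : nat := (\sum_i m (mxvec_index a i))%N.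

Definition weight m j : int :=
  \sum_a \sum_i (m (mxvec_index a i))%:Z * w i j.

Lemma row_degD m g a : row_deg (m + g)%MM a = (row_deg m a + row_deg g a)%N.
Proof.
by rewrite /row_deg -big_split; apply: eq_bigr => i _; rewrite mnmDE.
Qed.

Lemma row_deg0 a : row_deg 0%MM a = 0%N.
Proof. by rewrite /row_deg big1 // => i _; rewrite mnmE. Qed.

Lemma row_deg_sum (s : seq 'X_{1..n * k}) a :
  row_deg (\sum_(x <- s) x)%MM a = (\sum_(x <- s) row_deg x a)%N.
Proof.
exact: (big_morph (fun x => row_deg x a) (fun x y => row_degD x y a)
  (row_deg0 a)).
Qed.

Lemma weightD m g j : weight (m + g)%MM j = weight m j + weight g j.
Proof.
rewrite /weight -big_split; apply: eq_bigr => a _ /=.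
by rewrite -big_split; apply: eq_bigr => i _; rewrite mnmDE PoszD mulrDl.
Qed.

Lemma weight0 j : weight 0%MM j = 0.
Proof.
by rewrite /weight big1 // => a _; rewrite big1 // => i _; rewrite mnmE mul0r.
Qed.

Lemma row_degB m g a : (g <= m)%MM ->
  row_deg (m - g)%MM a = (row_deg m a - row_deg g a)%N.
Proof. by move=> le; rewrite -{2}(submK le) row_degD addnK. Qed.

Lemma weightB m g j : (g <= m)%MM ->
  weight (m - g)%MM j = weight m j - weight g j.
Proof. by move=> le; rewrite -{2}(submK le) weightD addrK. Qed.

(** The monoid M_n of invariant monomials, graded by the common row sum. *)
Definition inv_mon d m : Prop :=
  (forall a, row_deg m a = d) /\ (forall j, weight m j = 0).

Lemma inv_mon0 : inv_mon 0 0%MM.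
Proof. by split=> [a|j]; [exact: row_deg0 | exact: weight0]. Qed.

Lemma inv_monD d e m g :
  inv_mon d m -> inv_mon e g -> inv_mon (d + e) (m + g)%MM.
Proof.
move=> [dm wm] [dg wg]; split=> [a|j]; first by rewrite row_degD dm dg.
by rewrite weightD wm wg addr0.
Qed.

Lemma inv_monB d e m g : (g <= m)%MM -> inv_mon d m -> inv_mon e g ->
  inv_mon (d - e) (m - g)%MM.
Proof.
move=> le [dm wm] [dg wg]; split=> [a|j]; first by rewrite row_degB // dm dg.
by rewrite weightB // wm wg subr0.
Qed.

End Monomials.

(** * Halving a matrix at bounded cost in weight *)

(** A row is labelled by a pair of sets of columns, the odd entries of two
    matrices, whence the range of t: each label costs at most one row. *)
Definition weight_bound r k (w : 'M[int]_(k, r)) : nat :=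
  (\sum_(t : {set 'I_k} * {set 'I_k}) \sum_j \sum_i `|w i j|)%N.

Section Halving.
Context (r k : nat) (w : 'M[int]_(k, r)) (n : nat).
Local Notation mon := 'X_{1..n * k}.
Local Notation C := (weight_bound w).

Definition odd_set (m : mon) a : {set 'I_k} :=
  [set i | odd (m (mxvec_index a i))].

Lemma row_deg_odd (m : mon) a :
  row_deg m a =
  ((\sum_i (m (mxvec_index a i))./2).*2 + #|odd_set m a|)%N.
Proof.
rewrite /row_deg -sum1_card [X in (_ + X)%N]big_mkcond /= -mul2n.
rewrite big_distrr -big_split /=.
by apply: eq_bigr => i _; rewrite inE; case: ifP => /=; lia.
Qed.

Definition half_up (m : mon) (S : 'I_n -> {set 'I_k}) : mon :=
  mon_of (fun a i => (m (mxvec_index a i))./2 + (i \in S a))%N.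

Lemma half_up_le (m : mon) (S : 'I_n -> {set 'I_k}) :
  (forall a, S a \subset odd_set m a) -> (half_up m S <= m)%MM.
Proof.
move=> sS; apply/mon_lepP => a i; rewrite mon_ofE.
have /implyP := subsetP (sS a) i; rewrite inE.
by case: (i \in S a) => /=; lia.
Qed.

Lemma row_deg_half_up (m : mon) (S : 'I_n -> {set 'I_k}) a e :
  (#|S a|.*2 = #|odd_set m a|)%N ->
  row_deg m a = e.*2 -> row_deg (half_up m S) a = e.
Proof.
move=> cS; rewrite row_deg_odd -cS => em.
rewrite /row_deg.
under eq_bigr => i _ do rewrite mon_ofE.
have -> : (\sum_i ((m (mxvec_index a i))./2 + (i \in S a)) =
    \sum_i (m (mxvec_index a i))./2 + #|S a|)%N.
  rewrite big_split -sum1_card [X in _ = (_ + X)%N]big_mkcond /=.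
  by congr (_ + _)%N.
lia.
Qed.

Lemma weight_half_up (m : mon) (S : 'I_n -> {set 'I_k}) j :
  (weight w (half_up m S) j) *+ 2 - weight w m j =
  \sum_a \sum_i ((i \in S a)%:Z *+ 2 - (i \in odd_set m a)%:Z) * w i j.
Proof.
rewrite /weight -sumrMnl -sumrB; apply: eq_bigr => a _.
rewrite -sumrMnl -sumrB; apply: eq_bigr => i _.
rewrite mon_ofE -mulrnAl -mulrBl inE.
by congr (_ * _); lia.
Qed.

Lemma sumz_nat (I : finType) (F : I -> nat) :
  (\sum_i F i)%N%:Z = \sum_i (F i)%:Z.
Proof. exact: (big_morph Posz PoszD (erefl 0%:Z)). Qed.

(** Twice the weight of the half minus the weight is a sum over the rows, where
    exchanging U with its complement in X changes the sign of a term. *)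
Lemma weight_signed_half (m : mon) (sg : 'I_n -> bool)
    (tau : 'I_n -> {set 'I_k} * {set 'I_k})
    (X U : {set 'I_k} * {set 'I_k} -> {set 'I_k}) j :
  (forall a, odd_set m a = X (tau a)) ->
  (forall a, U (tau a) \subset X (tau a)) ->
  (forall delta : _ -> int,
     `|\sum_a (-1) ^+ sg a * delta (tau a)| <= \sum_t `|delta t|) ->
  `|weight w (half_up m
      (fun a => if sg a then X (tau a) :\: U (tau a) else U (tau a))) j *+ 2
    - weight w m j| <= C%:Z.
Proof.
move=> oX sU sgP; rewrite weight_half_up.
pose v t i : int := ((i \in U t) && (i \in X t))%:Z *+ 2 - (i \in X t)%:Z.
rewrite (eq_bigr (fun a => (-1) ^+ sg a * \sum_i v (tau a) i * w i j));
    last first.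
  move=> a _; rewrite big_distrr /=; apply: eq_bigr => i _; rewrite mulrA oX.
  congr (_ * _); rewrite /v; have /implyP := subsetP (sU a) i.
  by case: (sg a); rewrite ?inE; case: (i \in U _); case: (i \in X _).
apply: le_trans (sgP (fun t => \sum_i v t i * w i j)) _.
rewrite /weight_bound sumz_nat; apply: ler_sum => t _.
rewrite sumz_nat (bigD1 j) //= ler_wpDr //.
  by apply: sumr_ge0.
rewrite sumz_nat; apply: le_trans (ler_norm_sum _ _ _) _; apply: ler_sum => i _.
rewrite normrM abszE ler_piMl // /v.
by case: (i \in U _); case: (i \in X _).
Qed.

(** Entrywise A / 2 + B / 2 <= m, and rounding can only break this at an entry
    that is odd in both A and B and is rounded up in both, which disjointness of
    the chosen halves of the odd sets excludes. *)
Lemma joint_halving (m A B : mon) e f :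
  (forall a, row_deg A a = e.*2) -> (forall a, row_deg B a = f.*2) ->
  (A <= m)%MM -> (B <= m)%MM ->
  exists A' B' : mon,
    [/\ forall a, row_deg A' a = e, forall a, row_deg B' a = f,
        (A' <= A)%MM, (B' <= B)%MM & (A' + B' <= m)%MM] /\
    forall j, `|weight w A' j *+ 2 - weight w A j| <= C%:Z /\
              `|weight w B' j *+ 2 - weight w B j| <= C%:Z.
Proof.
move=> dA dB leA leB.
have evA a : ~~ odd #|odd_set A a|.
  by have := row_deg_odd A a; rewrite dA; lia.
have evB a : ~~ odd #|odd_set B a|.
  by have := row_deg_odd B a; rewrite dB; lia.
pose tau a := (odd_set A a, odd_set B a).
have /choice[H HP] : forall t : {set 'I_k} * {set 'I_k},
    exists UV : {set 'I_k} * {set 'I_k}, ~~ odd #|t.1| -> ~~ odd #|t.2| ->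
    [/\ UV.1 \subset t.1 /\ UV.2 \subset t.2, (#|UV.1|.*2 = #|t.1|)%N,
        (#|UV.2|.*2 = #|t.2|)%N, [disjoint UV.1 & UV.2]
        & [disjoint t.1 :\: UV.1 & t.2 :\: UV.2]].
  move=> t; have [[e1 e2]|ne] := pselect (~~ odd #|t.1| /\ ~~ odd #|t.2|).
    by have [UV UVP] := disjoint_halves e1 e2; exists UV.
  by exists t => e1 e2; case: ne.
have [sg sgP] := balanced_signs tau.
have {}HP a := HP (tau a) (evA a) (evB a).
pose S a := if sg a then (tau a).1 :\: (H (tau a)).1 else (H (tau a)).1.
pose S' a := if sg a then (tau a).2 :\: (H (tau a)).2 else (H (tau a)).2.
exists (half_up A S), (half_up B S'); split; last first.
  move=> j; split.
    apply: (@weight_signed_half A sg tau fst (fun t => (H t).1)) => // a.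
    by have [[]] := HP a.
  apply: (@weight_signed_half B sg tau snd (fun t => (H t).2)) => // a.
  by have [[]] := HP a.
have sS a : S a \subset odd_set A a.
  have [[s1 s2] _ _ _ _] := HP a; rewrite /S; case: ifP => // _.
  by rewrite subDset subsetUr.
have sS' a : S' a \subset odd_set B a.
  have [[s1 s2] _ _ _ _] := HP a; rewrite /S'; case: ifP => // _.
  by rewrite subDset subsetUr.
split.
- move=> a; apply: row_deg_half_up (dA a); have [[s1 s2] c1 c2 _ _] := HP a.
  rewrite /S; case: ifP => // _; rewrite cardsD (setIidPr s1) /= in c1 *.
  by move: c1; rewrite /tau /=; lia.
- move=> a; apply: row_deg_half_up (dB a); have [[s1 s2] c1 c2 _ _] := HP a.
  rewrite /S'; case: ifP => // _; rewrite cardsD (setIidPr s2) /= in c2 *.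
  by move: c2; rewrite /tau /=; lia.
- exact: half_up_le.
- exact: half_up_le.
apply/mon_lepP => a i; rewrite mnmDE !mon_ofE.
have /mon_lepP/(_ a i) := leA; have /mon_lepP/(_ a i) := leB.
have : ~~ ((i \in S a) && (i \in S' a)).
  have [_ _ _ d1 d2] := HP a; apply/negP => /andP[].
  rewrite /S /S'; case: ifP => _ iS iS'.
    by have := disjointFr d2 iS; rewrite iS'.
  by have := disjointFr d1 iS; rewrite iS'.
have /implyP := subsetP (sS a) i; have /implyP := subsetP (sS' a) i.
rewrite !inE.
by case: (i \in S a); case: (i \in S' a) => //=; lia.
Qed.
End Halving.

(** * Divisors of weight zero *)

Lemma pigeonhole (T : finType) (N : nat) (c : nat -> T) : (#|T| <= N)%N ->
  exists i j, [/\ (i < j)%N, (j <= N)%N & c i = c j].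
Proof.
move=> leTN; pose c' (i : 'I_N.+1) := c i.
have [inj|] := boolP (injectiveb c').
  by have := leq_card c' (injectiveP _ inj); rewrite card_ord; lia.
case/injectivePn => i [j neq eqc]; have := ltn_ord i; have := ltn_ord j.
have [lt|lt|/ord_inj eqij] := ltngtP i j; last by rewrite eqij eqxx in neq.
  by move=> ltj _; exists i, j; split.
by move=> _ lti; exists j, i; split.
Qed.

Lemma lepm_add (N : nat) (m1 m2 n1 n2 : 'X_{1..N}) :
  (m1 <= n1)%MM -> (m2 <= n2)%MM -> (m1 + m2 <= n1 + n2)%MM.
Proof.
move=> /mnm_lepP le1 /mnm_lepP le2; apply/mnm_lepP => i.
by rewrite !mnmDE leq_add.
Qed.

Section Parts.
Context (r k : nat) (w : 'M[int]_(k, r)) (n : nat).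
Local Notation mon := 'X_{1..n * k}.
Local Notation C := (weight_bound w).

Lemma halving (A : mon) e : (forall a, row_deg A a = e.*2) ->
  exists2 A' : mon, (A' <= A)%MM /\ (forall a, row_deg A' a = e) &
    forall j, `|weight w A j| <= C%:Z -> `|weight w A' j| <= C%:Z.
Proof.
move=> dA; have d0 a : row_deg (0%MM : mon) a = 0.*2 by rewrite row_deg0.
have [|A' [B' [[dA' _ leA' _ _] wA']]] :=
  @joint_halving _ _ w _ A A 0%MM e 0 dA d0 (lepm_refl A).
  by apply/mnm_lepP => i; rewrite mnmE.
by exists A' => // j; have [+ _] := wA' j; lia.
Qed.

(** The number of points of the box [-C, C]^r. *)
Definition box_card : nat := #|{ffun 'I_r -> 'I_(C.*2.+1)}|.

(** Halving keeps the weight in the box, so among the successive halves of A two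
    have the same weight, and their difference is invariant. *)
Lemma zero_weight_part (A : mon) d q : (0 < d)%N -> (box_card <= q)%N ->
  (forall a, row_deg A a = d * 2 ^ q)%N ->
  (forall j, `|weight w A j| <= C%:Z) ->
  exists e f, [/\ (0 < e)%N, inv_mon w e f & (f <= A)%MM].
Proof.
move=> d0 leCq dA wA.
have /choice[H HP] : forall eA : nat * mon, exists A' : mon,
    (forall a, row_deg eA.2 a = eA.1.*2) ->
    [/\ (A' <= eA.2)%MM, (forall a, row_deg A' a = eA.1) &
     forall j, `|weight w eA.2 j| <= C%:Z -> `|weight w A' j| <= C%:Z].
  move=> [e B]; have [dB|ndB] := pselect (forall a, row_deg B a = e.*2).
    by have [B' [le dB'] wB'] := halving dB; exists B'.
  by exists 0%MM => /ndB.
pose s := fix s i := if i is i'.+1 then H (d * 2 ^ (q - i'.+1), s i')%N else A.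
have sP i : (i <= q)%N -> (forall a, row_deg (s i) a = d * 2 ^ (q - i))%N /\
    forall j, `|weight w (s i) j| <= C%:Z.
  elim: i => [|i IHi] leiq; first by rewrite subn0.
  have [di wi] := IHi (ltnW leiq).
  have [|_ di' wi'] := HP (d * 2 ^ (q - i.+1), s i)%N.
    move=> a; rewrite di /= -[(q - i)%N]/(q.+1 - i.+1)%N subSn //.
    by rewrite expnS mulnCA mul2n.
  by split=> [//|j]; exact/wi'/wi.
have s_anti i j : (i <= j)%N -> (j <= q)%N -> (s j <= s i)%MM.
  move=> leij; rewrite -(subnKC leij); elim: (j - i)%N => [|l IHl] leq'.
    by rewrite addn0 lepm_refl.
  rewrite addnS in leq' *; apply: lepm_trans (IHl (ltnW leq')).
  have [dl _] := sP _ (ltnW leq').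
  have [|le _ _] := HP (d * 2 ^ (q - (i + l).+1), s (i + l))%N => //.
  move=> a; rewrite dl /= -[(q - (i + l))%N]/(q.+1 - (i + l).+1)%N subSn //.
  by rewrite expnS mulnCA mul2n.
(* Shifting by C makes the weight a natural number at most 2 C. *)
pose c i : {ffun 'I_r -> 'I_(C.*2.+1)} :=
  [ffun j => inord (absz (weight w (s i) j + C%:Z))].
have [i [i' [ltii' lei'q eqc]]] := pigeonhole c leCq.
have leiq : (i <= q)%N by apply: leq_trans (ltnW ltii') lei'q.
have [di wi] := sP _ leiq; have [di' wi'] := sP _ lei'q.
have les := s_anti _ _ (ltnW ltii') lei'q.
exists (d * 2 ^ (q - i) - d * 2 ^ (q - i'))%N, (s i - s i')%MM; split.
- by rewrite subn_gt0 ltn_pmul2l // ltn_exp2l //; lia.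
- split=> [a|j]; first by rewrite row_degB // di di'.
  have := wi j; have := wi' j; rewrite weightB //.
  move/ffunP/(_ j): eqc; rewrite !ffunE => /(congr1 val) /= + b1 b2.
  by rewrite !inordK; lia.
- exact: lepm_trans (lem_subr _ _) (s_anti 0%N i isT leiq).
Qed.

(** Two of the first N + 1 partial sums have the same degree modulo N. *)
Lemma partial_sum_part (a0 : 'I_n) (N : nat) (s : seq mon) :
  (0 < N)%N -> (N <= size s)%N ->
  (forall x, x \in s -> exists e, (0 < e)%N /\ inv_mon w e x) ->
  exists d A, [/\ (0 < d)%N, inv_mon w (d * N) A & (A <= \sum_(x <- s) x)%MM].
Proof.
move=> N0 leN sP.
pose S i : mon := (\sum_(x <- take i s) x)%MM.
pose D i := row_deg (S i) a0.
have SS i : (i < size s)%N -> S i.+1 = (S i + nth 0%MM s i)%MM.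
  by move=> lti; rewrite /S (take_nth 0%MM lti) -cats1 big_cat big_seq1.
have Sinv i : (i <= size s)%N -> inv_mon w (D i) (S i).
  elim: i => [_|i IHi lti].
    by rewrite /D /S take0 big_nil row_deg0; exact: inv_mon0.
  have [e [_ eP]] := sP _ (mem_nth 0%MM lti).
  rewrite /D SS // row_degD -/(D i); apply: inv_monD (IHi (ltnW lti)) _.
  by have [-> _] := eP.
have Smono i j : (i <= j)%N -> (j <= size s)%N ->
    (S i <= S j)%MM /\ (D i + (j - i) <= D j)%N.
  move=> leij; rewrite -(subnKC leij); elim: (j - i)%N => [|l IHl] ltl.
    by rewrite addn0 subnn addn0 lepm_refl.
  rewrite addnS in ltl *; have [le1 le2] := IHl (ltnW ltl).
  have [e [e0 [eP _]]] := sP _ (mem_nth 0%MM ltl).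
  rewrite SS //; split; first exact: lepm_trans le1 (lem_addr _ _).
  have -> : D (i + l).+1 = (D (i + l) + e)%N by rewrite /D SS // row_degD eP.
  lia.
have [|i [j [ltij lejN eqD]]] :=
  @pigeonhole _ N (fun i => Ordinal (ltn_pmod (D i) N0)).
  by rewrite card_ord.
have lej := leq_trans lejN leN.
have [leS ltD] := Smono i j (ltnW ltij) lej.
have /divnK dvdD : (N %| D j - D i)%N.
  by rewrite -eqn_mod_dvd; [move/(congr1 val): eqD => /= -> | lia].
exists ((D j - D i) %/ N)%N, (S j - S i)%MM; split.
- by rewrite lt0n; apply/eqP => E; move: dvdD; rewrite E mul0n; lia.
- by rewrite dvdD; apply: inv_monB => //; apply: Sinv; lia.
- apply: lepm_trans (lem_subr _ _) _.
  by rewrite /S -{2}(cat_take_drop j s) big_cat /= lem_addr.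
Qed.

(** Halving A <= m - g and B <= m - h together brings them to divisors A' and B'
    with A' + B' <= m and weights in the box; f and f' are then invariant
    divisors of A' and B'. *)
Lemma compatible_parts (a0 : 'I_n) (m g h : mon) (sg sh : seq mon) :
  (g <= m)%MM -> (h <= m)%MM ->
  (forall x, x \in sg ++ sh -> exists e, (0 < e)%N /\ inv_mon w e x) ->
  (\sum_(x <- sg) x = m - g)%MM -> (\sum_(x <- sh) x = m - h)%MM ->
  (2 ^ box_card.+1 <= size sg)%N -> (2 ^ box_card.+1 <= size sh)%N ->
  exists f f', [/\ exists2 e, (0 < e)%N & inv_mon w e f,
    exists2 e, (0 < e)%N & inv_mon w e f',
    (g + f <= m)%MM, (h + f' <= m)%MM & (f + f' <= m)%MM].
Proof.
move=> leg leh sP sumg sumh szg szh.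
have N0 : (0 < 2 ^ box_card.+1)%N by rewrite expn_gt0.
have [|dA [A [dA0 [dA_ wA] leA]]] := partial_sum_part a0 N0 szg.
  by move=> x xs; apply: sP; rewrite mem_cat xs.
have [|dB [B [dB0 [dB_ wB] leB]]] := partial_sum_part a0 N0 szh.
  by move=> x xs; apply: sP; rewrite mem_cat xs orbT.
rewrite sumg in leA; rewrite sumh in leB.
have dbl d : (d * 2 ^ box_card.+1 = (d * 2 ^ box_card).*2)%N.
  by rewrite expnS mulnCA mul2n.
have [||A' [B' [[dA' dB' leA' leB' leAB] wAB']]] := @joint_halving _ _ w _ m A B
    (dA * 2 ^ box_card) (dB * 2 ^ box_card) _ _
    (lepm_trans leA (lem_subr _ _)) (lepm_trans leB (lem_subr _ _)).
- by move=> a; rewrite dA_ dbl.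
- by move=> a; rewrite dB_ dbl.
have [|e [f [e0 fP lef]]] := zero_weight_part dA0 (leqnn _) dA'.
  by move=> j; have [+ _] := wAB' j; rewrite wA; lia.
have [|e' [f' [e'0 f'P lef']]] := zero_weight_part dB0 (leqnn _) dB'.
  by move=> j; have [_ +] := wAB' j; rewrite wB; lia.
exists f, f'; split; [by exists e | by exists e' | | | ].
- rewrite -(submK leg) addmC lepm_add ?lepm_refl //.
  exact: lepm_trans lef (lepm_trans leA' leA).
- rewrite -(submK leh) addmC lepm_add ?lepm_refl //.
  exact: lepm_trans lef' (lepm_trans leB' leB).
- exact: lepm_trans (lepm_add lef lef') leAB.
Qed.

End Parts.

(** * Invariants are spanned by invariant monomials *)

Section Support.
Context (C : nzRingType) (N : nat).
Implicit Types (F G : {mpoly C[N]}) (Q : 'X_{1..N} -> Prop).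

Definition supported Q F : Prop := forall m, m \in msupp F -> Q m.

Lemma supported0 Q : supported Q 0.
Proof. by move=> m; rewrite msupp0. Qed.

Lemma supportedX Q m : Q m -> supported Q 'X_[m].
Proof. by move=> Qm _ /mem_msuppXP <-. Qed.

Lemma supportedZD Q c F G :
  supported Q F -> supported Q G -> supported Q (c *: F + G).
Proof.
move=> sF sG m /msuppD_le; rewrite mem_cat => /orP[/msuppZ_le|].
  exact: sF.
exact: sG.
Qed.

Lemma supported_sum Q (I : Type) (s : seq I) (P : pred I) (a : I -> C)
    (F : I -> {mpoly C[N]}) :
  (forall i, P i -> supported Q (F i)) ->
  supported Q (\sum_(i <- s | P i) a i *: F i).
Proof.
move=> sF; elim/big_rec: _ => [|i G Pi]; first exact: supported0.
by apply: supportedZD; exact: sF.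
Qed.

Lemma supportedM Q1 Q2 Q F G :
  (forall m1 m2, Q1 m1 -> Q2 m2 -> Q (m1 + m2)%MM) ->
  supported Q1 F -> supported Q2 G -> supported Q (F * G).
Proof.
move=> QD sF sG m /msuppM_le /allpairsP[[m1 m2] /= [m1F m2G ->]].
by apply: QD; [exact: sF | exact: sG].
Qed.
End Support.

Section Invariants.
Context (C : numFieldType) (r k : nat) (w : 'M[int]_(k, r)) (n : nat).
Local Notation mon := 'X_{1..n * k}.
Local Notation A := {mpoly C[n * k]}.

Lemma row_deg_tensor_in (b a : 'I_n) d (f : {mpoly C[k]}) : f \is d.-homog ->
  supported (fun m : mon => row_deg m a = if b == a then d else 0%N)
    (tensor_in b f).
Proof.
move=> /dhomogP df; rewrite /tensor_in comp_mpolyE big_seq.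
apply: supported_sum => e /df de.
suff -> : \prod_(i < k) tnth [tuple 'X_(mxvec_index b i1)  | i1 < k] i ^+ e i =
    'X_[mon_of (fun a i => if a == b then e i else 0%N)] :> A.
  apply: supportedX; rewrite /row_deg.
  rewrite (eq_bigr (fun i => if a == b then e i else 0%N)).
    by rewrite eq_sym; case: ifP => _; rewrite ?big1_eq // -de /= mdegE.
  by move=> i _; rewrite mon_ofE.
rewrite [RHS]mpolyXE_id (reindex _ (curry_mxvec_bij n k)) /=.
transitivity (\prod_(a < n) \prod_(i < k) ('X_(mxvec_index a i) : A)
    ^+ (if a == b then e i else 0%N)); last first.
  by rewrite pair_bigA; apply: eq_bigr => -[a' i] _ /=; rewrite mon_ofE.
rewrite (bigD1 b) //= eqxx [X in _ * X]big1 ?mulr1; last first.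
  by move=> a' /negPf ->; rewrite big1.
by apply: eq_bigr => i _; rewrite tnth_mktuple.
Qed.

Lemma row_deg_segre d (F : A) : segre_deg d F ->
  supported (fun m : mon => forall a, row_deg m a = d) F.
Proof.
move=> [p [c [G [GP ->]]]]; apply: supported_sum => l _.
have [f [df ->]] := GP l; move=> m mF a; move: m mF.
rewrite /tensor (bigD1 a) //=.
apply: (@supportedM _ _ (fun m => row_deg m a = d)
  (fun m => row_deg m a = 0%N)).
- by move=> m1 m2 d1 d2; rewrite row_degD d1 d2 addn0.
- by have := @row_deg_tensor_in a a _ _ (df a); rewrite eqxx.
elim/big_rec: _ => [|b G' ba].
  by rewrite -mpolyX0; apply: supportedX; rewrite row_deg0.
apply: supportedM (@row_deg_tensor_in b a _ _ (df b)) => m1 m2.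
by rewrite row_degD (negPf ba) => -> ->.
Qed.

Lemma tensor_actX (t : 'I_r -> C) (m : mon) : in_torus t ->
  tensor_act w t 'X_[m] = (\prod_j t j ^ weight w m j) *: 'X_[m].
Proof.
move=> t0; rewrite /tensor_act comp_mpolyX (reindex _ (curry_mxvec_bij n k)) /=.
rewrite (eq_bigr (fun p : 'I_n * 'I_k =>
  (weight_char w t p.2 ^+ m (mxvec_index p.1 p.2)) *:
  ('X_(mxvec_index p.1 p.2) : A) ^+ m (mxvec_index p.1 p.2))); last first.
  by move=> [a i] _; rewrite tnth_mktuple mxvecE mxE exprZn.
rewrite scaler_prod; congr (_ *: _); last first.
  rewrite [RHS]mpolyXE_id (reindex _ (curry_mxvec_bij n k)).
  by apply: eq_bigr => -[].
rewrite -(pair_bigA _ (fun a i => weight_char w t i ^+ m (mxvec_index a i))) /=.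
have powsum (I : finType) (x : C) (z : I -> int) : x != 0 ->
    x ^ (\sum_i z i) = \prod_i x ^ z i.
  by move=> x0; apply: (big_morph _ (fun y z => expfzDr y z x0) (expr0z x)).
under eq_bigr => a _.
  under eq_bigr => i _ do rewrite /weight_char -prodrXl.
  rewrite exchange_big /=.
  over.
rewrite exchange_big; apply: eq_bigr => j _ /=.
rewrite powsum //; apply: eq_bigr => a _; rewrite powsum //.
by apply: eq_bigr => i _; rewrite mulrC -exprz_exp.
Qed.

(** The torus acts on a monomial through its weight, and a nonzero weight is
    detected by the torus element with a single coordinate equal to 2, which is
    not a root of unity. *)
Lemma inv_deg_supported d (F : A) : inv_deg w d F -> supported (inv_mon w d) F.
Proof.
move=> [sF iF] m mF; split; first exact: row_deg_segre mF.
move=> j; pose t j' : C := if j' == j then 2 else 1.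
have t0 : in_torus t.
  by move=> j'; rewrite /t; case: ifP; rewrite ?pnatr_eq0 ?oner_eq0.
have := iF t t0; rewrite /tensor_act comp_mpolyEX => /(congr1 (mcoeff m)).
rewrite raddf_sum /= (bigD1_seq m) ?msupp_uniq //= big1; last first.
  move=> m' /negPf neq; rewrite -/(tensor_act w t _) tensor_actX //.
  by rewrite !mcoeffZ mcoeffX neq !mulr0.
rewrite -/(tensor_act w t _) tensor_actX // !mcoeffZ mcoeffX eqxx addr0 mulr1.
move=> chi; have {chi} : \prod_j0 t j0 ^ weight w m j0 = 1.
  by apply: (mulfI (x := F@_m)); rewrite ?mulr1 // -mcoeff_msupp.
rewrite (bigD1 j) //= big1 => [|j' /negPf neq]; last by rewrite /t neq exp1rz.
rewrite mulr1 /t eqxx => /eqP.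
by rewrite pexprz_eq1 ?ler0n // (eqr_nat _ 2 1) orbF => /eqP.
Qed.

Lemma inv_degX d (m : mon) : inv_mon w d m -> inv_deg w d ('X_[m] : A).
Proof.
move=> [dm wm]; split=> [|t t0]; last first.
  by rewrite tensor_actX // big1 ?scale1r // => j _; rewrite wm expr0z.
apply: lin_span_gen.
exists (fun a => 'X_[[multinom m (mxvec_index a i) | i < k]]); split=> [a|].
  rewrite dhomogX /= mdegE -(dm a); apply/eqP/eq_bigr => i _; exact: mnmE.
rewrite tensorX; congr 'X_[_]; apply/mnmP; apply: mon_ind => a i.
by rewrite mnmE mxvecE mxE mnmE.
Qed.

Definition sum_of_gens d0 (m : mon) : Prop := exists2 s : seq mon,
  (forall x, x \in s -> exists2 d, (d <= d0)%N & inv_mon w d x) &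
  m = (\sum_(x <- s) x)%MM.

(** The polynomials all of whose monomials factor into invariant monomials of
    degree at most d0 form a subalgebra, which contains the generators. *)
Lemma sum_of_gensP d0 : generated_upto C w n d0 ->
  forall d m, inv_mon w d m -> sum_of_gens d0 m.
Proof.
move=> gen d m mP.
have : inv_ring w ('X_[m] : A).
  by exists d; apply: inv_deg_upto (leqnn d) (inv_degX mP).
move/gen/(_ (fun F => `[< supported (sum_of_gens d0) F >])) => H.
suff /asboolP : ('X_[m] : A) \in (fun F => `[< supported (sum_of_gens d0) F >]).
  by apply; apply/mem_msuppXP.
apply: H => [|G [e [le /inv_deg_supported sG]]]; last first.
  apply/asboolP => g /sG gP; exists [:: g] => [x|]; last by rewrite big_seq1.
  by rewrite mem_seq1 => /eqP ->; exists e.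
split.
- apply/asboolP; rewrite -mpolyX0; apply: supportedX; exists [::] => //.
  by rewrite big_nil.
- by move=> c F G /asboolP sF /asboolP sG; apply/asboolP; exact: supportedZD.
move=> F G /asboolP sF /asboolP sG; apply/asboolP; apply: supportedM sF sG.
move=> _ _ [s1 s1P ->] [s2 s2P ->]; exists (s1 ++ s2); last by rewrite big_cat.
by move=> x; rewrite mem_cat => /orP[]; [exact: s1P | exact: s2P].
Qed.
End Invariants.

(** * Products of generators span the symmetric algebra *)

Section SymAlgGen.
Context (K : comNzRingType) (W : lmodType K) (B : {pred sym_alg W}).
(** Carrying the closure proof in the predicate lets the type of its elements
    inherit an algebra structure. *)
Definition subalg_pred (clB : GRing.subalg_closed B) : {pred sym_alg W} := B.
Context (clB : GRing.subalg_closed B).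
HB.instance Definition _ :=
  GRing.isSubalgClosed.Build K (sym_alg W) (subalg_pred clB) clB.
Definition subalg_type : Type := {p : sym_alg W | p \in subalg_pred clB}.
HB.instance Definition _ := SubChoice.on subalg_type.
HB.instance Definition _ := [SubChoice_isSubComNzRing of subalg_type by <:].
HB.instance Definition _ := [SubZmodule_isSubLmodule of subalg_type by <:].
HB.instance Definition _ :=
  [SubNzRing_SubLmodule_isSubLalgebra of subalg_type by <:].
HB.instance Definition _ := GRing.Lalgebra_isComAlgebra.Build K subalg_type.

(** By the universal property the map from W factors through the subalgebra B,
    and by uniqueness the composite with the inclusion of B is the identity. *)
Lemma subalg_full :
  (forall u, sym_in W u \in B) -> forall p, p \in B.
Proof.
move=> Bin p; pose f u : subalg_type := exist _ (sym_in W u) (Bin u).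
have f_lin : linear f by move=> a u v; apply: val_inj; rewrite /= linearP.
pose mx := GRing.isLinear.Build K W subalg_type *:%R f f_lin.
pose fl : {linear W -> subalg_type} := HB.pack f mx.
pose incl (q : subalg_type) : sym_alg W := \val q.
pose mD := GRing.isZmodMorphism.Build subalg_type (sym_alg W) incl
  (fun _ _ => erefl).
pose mM := GRing.isMonoidMorphism.Build subalg_type (sym_alg W) incl
  (conj erefl (fun _ _ => erefl)).
pose mZ := GRing.isScalable.Build K subalg_type (sym_alg W) *:%R incl
  (fun _ _ => erefl).
pose v : {lrmorphism subalg_type -> sym_alg W} := HB.pack incl mD mM mZ.
pose g : {lrmorphism sym_alg W -> sym_alg W} := v \o sym_lift fl.
have gP : g =1 sym_lift (sym_in W).
  by apply: sym_lift_unique => u; rewrite /= sym_lift_in.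
have idP : idfun =1 sym_lift (sym_in W) by exact: sym_lift_unique.
rewrite -[p]/(idfun p) idP -gP.
exact: valP (sym_lift fl p).
Qed.
End SymAlgGen.

Lemma sym_alg_spanned (K : comNzRingType) (W : lmodType K) (Q : W -> Prop) :
  (forall u, lin_span Q u) ->
  forall p : sym_alg W, lin_span (fun q => exists2 s : seq W,
    (forall x, x \in s -> Q x) & q = \prod_(x <- s) sym_in W x) p.
Proof.
move=> spanQ p; set G := fun q => _.
pose B : {pred sym_alg W} := fun q => `[< lin_span G q >].
have spanM x y : lin_span G x -> lin_span G y -> lin_span G (x * y).
  have G1 a z : G a -> lin_span G z -> lin_span G (a * z).
    move=> [s sQ ->] [l [b [h [Gh ->]]]]; rewrite big_distrr /=.
    exists l, b, (fun i => \prod_(x <- s) sym_in W x * h i); split=> [i|].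
      have [s' s'Q ->] := Gh i; exists (s ++ s'); last by rewrite big_cat.
      by move=> v; rewrite mem_cat => /orP[]; [exact: sQ | exact: s'Q].
    by apply: eq_bigr => i _; rewrite scalerAr.
  move=> [l [b [h [Gh ->]]]] sy; rewrite big_distrl /=.
  elim/big_rec: _ => [|i z _ sz]; first exact: lin_span0.
  by rewrite -scalerAl; apply: lin_spanZD sz; exact: G1.
apply/asboolP; apply: (@subalg_full _ _ B) => [|u].
  split=> [|a x y /asboolP sx /asboolP sy|x y /asboolP sx /asboolP sy].
  - by apply/asboolP/lin_span_gen; exists [::] => //; rewrite big_nil.
  - by apply/asboolP; exact: lin_spanZD.
  - by apply/asboolP; exact: spanM.
have [l [b [h [Qh ->]]]] := spanQ u; apply/asboolP; rewrite linear_sum.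
elim/big_rec: _ => [|i z _ sz]; first exact: lin_span0.
rewrite linearZ; apply: lin_spanZD sz; apply: lin_span_gen; exists [:: h i].
  by move=> x; rewrite mem_seq1 => /eqP ->.
by rewrite big_seq1.
Qed.

(** * The kernel of the presentation *)

(** Monomials are linearly independent, so a linear relation between them
    persists when each is replaced by a vector depending only on it. *)
Lemma monomial_relation (K : nzRingType) (V : lmodType K) (N l : nat)
    (a : 'I_l -> K) (m : 'I_l -> 'X_{1..N}) (c : 'X_{1..N} -> V) :
  \sum_i a i *: 'X_[m i] = 0 :> {mpoly K[N]} -> \sum_i a i *: c (m i) = 0.
Proof.
move=> rel; pose z := undup (codom m).
have mz i : m i \in z by rewrite mem_undup codom_f.
rewrite (eq_bigr (fun i => \sum_(e <- z) (a i *+ (m i == e)) *: c e));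
    last first.
  move=> i _; rewrite (bigD1_seq (m i)) ?undup_uniq //= eqxx mulr1n.
  rewrite big1 ?addr0 //.
  by move=> e /negPf; rewrite eq_sym => ->; rewrite mulr0n scale0r.
rewrite exchange_big big1 // => e _; rewrite -scaler_suml.
suff -> : \sum_i a i *+ (m i == e) = 0 by rewrite scale0r.
rewrite -[RHS](mcoeff0 _ e) -rel raddf_sum; apply: eq_bigr => i _ /=.
by rewrite mcoeffZ mcoeffX mulr_natr.
Qed.

Section Ideals.
Context (K : comNzRingType) (P : comAlgType K) (G : P -> Prop).

Definition cong (p q : P) := ideal_span G (p - q).

Lemma ideal_spanM p q : ideal_span G q -> ideal_span G (p * q).
Proof.
move=> Iq; rewrite -[_ * _]addr0; apply: (lin_spanZD p Iq).
exact: lin_span0.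
Qed.

Lemma ideal_spanD p q :
  ideal_span G p -> ideal_span G q -> ideal_span G (p + q).
Proof. by move=> Ip Iq; rewrite -[p]mul1r; exact: (lin_spanZD 1 Ip). Qed.

Lemma cong_trans q p s : cong p q -> cong q s -> cong p s.
Proof. by move=> pq qs; rewrite /cong -(subrKA q); exact: ideal_spanD. Qed.

Lemma congM p q s : cong q s -> cong (p * q) (p * s).
Proof. by rewrite /cong -mulrBr; exact: ideal_spanM. Qed.
End Ideals.

Section Presentation.
Context (C : numFieldType) (r k : nat) (w : 'M[int]_(k, r)) (n d0 : nat).
Context (a0 : 'I_n).
Local Notation mon := 'X_{1..n * k}.
Local Notation A := {mpoly C[n * k]}.
Local Notation P := (pres_alg C w n d0).
Implicit Types (x g m : mon) (s t : seq mon).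

Definition generator x : Prop := exists2 d, (d <= d0)%N & inv_mon w d x.
Definition generators s : Prop := forall x, x \in s -> generator x.

Lemma inv_mon_deg d x : inv_mon w d x -> row_deg x a0 = d.
Proof. by case. Qed.

Lemma generatorX x : generator x -> ('X_[x] : A) \in inv_upto w d0.
Proof. by move=> [d le dx]; apply: inv_deg_upto le (inv_degX C dx). Qed.

(** The default value 0 is never taken at a generator. *)
Definition gen_elt x : inv_space C w n d0 := insubd 0 'X_[x].

Lemma val_gen_elt x : generator x -> \val (gen_elt x) = 'X_[x].
Proof. by move=> gx; rewrite val_insubd generatorX. Qed.

Lemma inv_space_spanned (u : inv_space C w n d0) :
  lin_span (fun v => exists2 x, generator x & v = gen_elt x) u.
Proof.
have suppu : supported generator (\val u).
  have /asboolP[F [FP ->]] := valP u.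
  rewrite (eq_bigr (fun d => 1 *: F d)) => [|d _]; last by rewrite scale1r.
  apply: supported_sum => d _ m /(inv_deg_supported (FP d)) mP.
  by exists d => //; rewrite -ltnS ltn_ord.
exists (size (msupp (\val u))),
  (fun i => (\val u)@_(nth 0%MM (msupp (\val u)) i)),
  (fun i => gen_elt (nth 0%MM (msupp (\val u)) i)); split=> [i|].
  by exists (nth 0%MM (msupp (\val u)) i) => //; exact/suppu/mem_nth.
apply: val_inj; rewrite [LHS]mpolyE raddf_sum /= (big_nth 0%MM) big_mkord.
apply: eq_bigr => i _; rewrite [in RHS]val_gen_elt //; exact/suppu/mem_nth.
Qed.

Definition gen_prod s : P := \prod_(x <- s) sym_in _ (gen_elt x).

Lemma pres_map_gen_prod s : generators s ->
  pres_map C w n d0 (gen_prod s) = 'X_[(\sum_(x <- s) x)%MM].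
Proof.
move=> gs; rewrite rmorph_prod -mpolyX_prod big_seq [RHS]big_seq.
apply: eq_bigr => x /gs gx.
by rewrite [LHS]sym_lift_in; exact: val_gen_elt.
Qed.

Lemma gen_prod_spanned (p : P) :
  lin_span (fun q => exists2 s, generators s & q = gen_prod s) p.
Proof.
have [l [a [h [hP ->]]]] := sym_alg_spanned inv_space_spanned p.
exists l, a, h; split=> // i; have [s + ->] := hP i.
elim: s => [_|u s IHs us].
  by exists [::] => //; rewrite /gen_prod !big_nil.
have [t gt st] :
    exists2 t, generators t & \prod_(x <- s) sym_in _ x = gen_prod t.
  by apply: IHs => v vs; apply: us; rewrite in_cons vs orbT.
have [x gx ->] := us _ (mem_head _ _).
exists (x :: t); last by rewrite /gen_prod !big_cons st.
by move=> y; rewrite in_cons => /predU1P[->|/gt].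
Qed.

Lemma gen_prod_multihomog s : generators s ->
  multihomog (row_deg (\sum_(x <- s) x)%MM a0) (gen_prod s).
Proof.
move=> gs; apply: lin_span_gen.
exists (size s), (fun j => row_deg (nth 0%MM s j) a0),
  (fun j => gen_elt (nth 0%MM s j)).
split=> [j||].
- have gj : generator (nth 0%MM s j) by apply/gs/mem_nth.
  rewrite val_gen_elt //; have [d le dP] := gj.
  by rewrite (inv_mon_deg dP); split=> //; exact: inv_degX.
- by rewrite row_deg_sum [RHS](big_nth 0%MM) big_mkord.
by rewrite /gen_prod (big_nth 0%MM) big_mkord.
Qed.

Lemma generators_cat s t : generators s -> generators t -> generators (s ++ t).
Proof. by move=> gs gt x; rewrite mem_cat => /orP[/gs|/gt]. Qed.

Lemma generators_inv s : generators s ->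
  inv_mon w (row_deg (\sum_(x <- s) x)%MM a0) (\sum_(x <- s) x)%MM.
Proof.
elim: s => [_|x s IHs gs]; first by rewrite big_nil row_deg0; exact: inv_mon0.
rewrite big_cons row_degD; have [d _ dP] := gs _ (mem_head _ _).
rewrite (inv_mon_deg dP); apply: inv_monD dP _; apply: IHs => y ys.
by apply: gs; rewrite in_cons ys orbT.
Qed.

Lemma inv_mon_eq0 x : inv_mon w 0 x -> x = 0%MM.
Proof.
move=> [x0 _]; apply/mnmP; apply: mon_ind => a i; rewrite mnmE.
by have /eqP := x0 a; rewrite sum_nat_eq0 => /forallP/(_ i)/eqP.
Qed.

Lemma deg_generators_le s : generators s ->
  (row_deg (\sum_(x <- s) x)%MM a0 <= d0 * size s)%N.
Proof.
elim: s => [_|x s IHs gs]; first by rewrite big_nil row_deg0.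
rewrite big_cons row_degD mulnS leq_add //.
  by have [d le /inv_mon_deg ->] := gs _ (mem_head _ _).
by apply: IHs => y ys; apply: gs; rewrite in_cons ys orbT.
Qed.

(** The unit of R_n is a generator of degree 0; discarding its copies leaves
    factors of positive degree, at least deg / d0 in number. *)
Lemma nonzero_generators s : generators s -> exists s' : seq mon,
  [/\ (\sum_(x <- s') x = \sum_(x <- s) x)%MM,
      forall x, x \in s' -> exists e, (0 < e)%N /\ inv_mon w e x &
      (row_deg (\sum_(x <- s) x)%MM a0 <= d0 * size s')%N].
Proof.
move=> gs; pose s' := [seq x <- s | x != 0%MM].
have sum' : (\sum_(x <- s') x = \sum_(x <- s) x)%MM.
  rewrite big_filter big_mkcond; apply: eq_bigr => x _.
  by case: eqP.
exists s'; split=> // [x|].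
  rewrite mem_filter => /andP[x0 /gs[e _ eP]]; exists e; split=> //.
  rewrite lt0n; apply: contraNneq x0 => e0; rewrite e0 in eP.
  exact/eqP/inv_mon_eq0.
rewrite -sum'; apply: deg_generators_le => x.
by rewrite mem_filter => /andP[_ /gs].
Qed.

Section Connected.
Context (gen : generated_upto C w n d0) (d1 : nat).
Hypothesis d1_large : (d0 * (2 ^ (box_card w).+1).+1 <= d1)%N.

Definition low_relation (p : P) : Prop :=
  pres_ideal p /\ exists e, (e <= d1)%N /\ multihomog e p.

Local Notation cong := (cong low_relation).
Local Notation deg m := (row_deg m a0).

(** The chain from s to t described at the top: swapping the cofactor of a fixed
    divisor of positive degree is a relation between products of smaller degree,
    hence known by induction. *)
Lemma fibre_connected s t : generators s -> generators t ->
  (\sum_(x <- s) x = \sum_(x <- t) x)%MM -> cong (gen_prod s) (gen_prod t).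
Proof.
have [D] := ubnP (deg (\sum_(x <- s) x)%MM).
elim: D s t => // D IH s t ltD gs gt.
set m := (\sum_(x <- s) x)%MM => eqm.
have [low|high] := leqP (deg m) d1.
  apply: lin_span_gen; split.
    by rewrite /pres_ideal [LHS]rmorphB /= !pres_map_gen_prod // -/m -eqm subrr.
  exists (deg m); split=> //; rewrite addrC -scaleN1r; apply: lin_spanZD.
    by rewrite eqm; exact: gen_prod_multihomog.
  exact: gen_prod_multihomog.
have swap u s' t' : generators s' -> generators t' -> (0 < deg u)%N -> 
    (u + \sum_(x <- s') x = m)%MM -> (\sum_(x <- t') x = \sum_(x <- s') x)%MM ->
    cong (gen_prod s') (gen_prod t').
  move=> gs' gt' u0 us' st; apply: IH => //.
  by move: ltD; rewrite ltnS -/m -us' row_degD; lia.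
have pick s' : generators s' -> (\sum_(x <- s') x = m)%MM ->
    exists g,
      [/\ g \in s', (0 < deg g)%N & (g + \sum_(x <- rem g s') x = m)%MM].
  move=> gs' sm; have [/hasP[g gs0 g0]|/hasPn no] :=
    boolP (has (fun g => 0 < deg g)%N s').
    by exists g; split=> //; rewrite -sm [RHS](big_rem g).
  suff : deg m = 0%N by lia.
  by rewrite -sm row_deg_sum big_seq big1 // => x /no; lia.
have [g [gs0 g0 sg]] := pick s gs erefl.
have [h [ht0 h0 th]] := pick t gt (esym eqm).
have mP : inv_mon w (deg m) m by exact: generators_inv.
have rem_gen s' x : generators s' -> generators (rem x s').
  by move=> gs' y /mem_rem /gs'.
have large x s' : generator x -> generators s' ->
    (x + \sum_(y <- s') y = m)%MM ->
    exists sx : seq mon, [/\ (x <= m)%MM, (\sum_(y <- sx) y = m - x)%MM,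
      (forall y, y \in sx -> exists e, (0 < e)%N /\ inv_mon w e y) &
      (2 ^ (box_card w).+1 <= size sx)%N].
  move=> [d led /inv_mon_deg dx] gs' xs'.
  have [sx [sumx sxP szx]] := nonzero_generators gs'.
  exists sx; split=> //; first by rewrite -xs' lem_addr.
    by rewrite sumx -xs' addmC addmK.
  have := congr1 (fun y => deg y) xs'; rewrite row_degD dx => dm.
  have lt : (d0 * 2 ^ (box_card w).+1 < d0 * size sx)%N.
    by have := d1_large; rewrite mulnS; lia.
  by rewrite ltnW //; move: lt; rewrite ltn_mul2l => /andP[].
have gg := gs _ gs0; have gh := gt _ ht0.
have [sx [leg sumg sgP szg]] := large _ _ gg (rem_gen _ _ gs) sg.
have [tx [leh sumh shP szh]] := large _ _ gh (rem_gen _ _ gt) th.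
have [|f [f' [[e e0 fP] [e' e'0 f'P] legf lehf' leff']]] :=
  compatible_parts a0 leg leh _ sumg sumh szg szh.
  by move=> x; rewrite mem_cat => /orP[/sgP|/shP].
have [eg _ gP] := gg; have [eh _ hP] := gh.
(* F, F', T, T', T'' factor f, f', m - g - f, m - f - f', m - h - f'. *)
have [F gF sF] := sum_of_gensP gen fP.
have [F' gF' sF'] := sum_of_gensP gen f'P.
have [T gT sT] := sum_of_gensP gen (inv_monB legf mP (inv_monD gP fP)).
have [T' gT' sT'] := sum_of_gensP gen (inv_monB leff' mP (inv_monD fP f'P)).
have [T'' gT'' sT''] := sum_of_gensP gen (inv_monB lehf' mP (inv_monD hP f'P)).
have catE s1 s2 : gen_prod (s1 ++ s2) = gen_prod s1 * gen_prod s2.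
  by rewrite /gen_prod big_cat.
have remE x s' : x \in s' ->
    gen_prod s' = gen_prod [:: x] * gen_prod (rem x s').
  by move=> xs'; rewrite /gen_prod (big_rem x) //= big_seq1.
have subE (u v z : mon) : (u + v <= z)%MM -> (u + (v + (z - (u + v))) = z)%MM.
  by move=> le; rewrite addmA addmC submK.
have addmCA (u v z : mon) : (u + (v + z) = v + (u + z))%MM.
  by rewrite !addmA (addmC u).
have gen1 x : generator x -> generators [:: x].
  by move=> gx y; rewrite mem_seq1 => /eqP ->.
have df : (0 < deg f)%N by rewrite (inv_mon_deg fP).
have df' : (0 < deg f')%N by rewrite (inv_mon_deg f'P).
rewrite (remE g) // (remE h t) //.
apply: (cong_trans (q := gen_prod [:: g] * (gen_prod F * gen_prod T))).
  apply: congM; rewrite -catE; apply: (swap g) => //.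
  - exact: rem_gen.
  - exact: generators_cat.
  - rewrite big_cat /= -sF -sT; apply: (@addmI _ g); rewrite sg.
    exact: subE.
rewrite mulrCA.
apply: (cong_trans (q := gen_prod F * (gen_prod F' * gen_prod T'))).
  apply: congM; rewrite -!catE; apply: (swap f) => //.
  - by apply: generators_cat => //; exact: gen1.
  - exact: generators_cat.
  - by rewrite big_cat big_seq1 /= -sT addmCA subE.
  - rewrite !big_cat big_seq1 /= -sF' -sT -sT'; apply: (@addmI _ f).
    by rewrite subE // [RHS]addmCA subE.
rewrite mulrCA.
apply: (cong_trans (q := gen_prod F' * (gen_prod [:: h] * gen_prod T''))).
  apply: congM; rewrite -!catE; apply: (swap f') => //.
  - exact: generators_cat.
  - by apply: generators_cat => //; exact: gen1.
  - by rewrite big_cat /= -sF -sT' addmCA subE.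
  - rewrite !big_cat big_seq1 /= -sF -sT' -sT''; apply: (@addmI _ f').
    by rewrite addmCA subE // addmCA subE.
rewrite mulrCA; apply: congM; rewrite -catE; apply: (swap h) => //.
- exact: generators_cat.
- exact: rem_gen.
- by rewrite big_cat /= -sF' -sT'' subE.
- rewrite big_cat /= -sF' -sT''; apply: (@addmI _ h); rewrite th.
  by rewrite subE.
Qed.

(** Replacing every product of generators by a standard one with the same image
    is a congruence, and turns an element of the kernel into 0. *)
Lemma kernel_spanned (p : P) : pres_ideal p <-> ideal_span low_relation p.
Proof.
split=> [p0|[l [a [h [hP ->]]]]]; last first.
  rewrite /pres_ideal rmorph_sum big1 // => i _.
  by have [hi0 _] := hP i; rewrite [LHS]rmorphM /= hi0 mulr0.
have [l [a [h [hP defp]]]] := gen_prod_spanned p.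
have /choice[u uP] : forall i, exists s, generators s /\ h i = gen_prod s.
  by move=> i; have [s] := hP i; exists s.
have /choice[c cP] : forall m : mon, exists s,
    (exists2 s', generators s' & (\sum_(x <- s') x = m)%MM) ->
    generators s /\ (\sum_(x <- s) x = m)%MM.
  move=> m; have [[s gs sm]|no] :=
    pselect (exists2 s', generators s' & (\sum_(x <- s') x = m)%MM).
    by exists s.
  by exists [::] => /no.
pose M i := (\sum_(x <- u i) x)%MM.
have canP i : generators (c (M i)) /\ (\sum_(x <- c (M i)) x = M i)%MM.
  by apply: cP; exists (u i) => //; have [] := uP i.
have rel : \sum_i a i *: gen_prod (c (M i)) = 0.
  apply: (monomial_relation (fun m => gen_prod (c m))).
  rewrite -[RHS]p0 defp linear_sum.
  apply: eq_bigr => i _; have [gu ->] := uP i.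
  by rewrite linearZ /= pres_map_gen_prod.
have -> : p = \sum_i a i *: (h i - gen_prod (c (M i))).
  rewrite -[LHS]subr0 -[X in _ - X = _]rel [in LHS]defp -sumrB.
  by apply: eq_bigr => i _; rewrite scalerBr.
elim/big_rec: _ => [|i q _ Iq]; first exact: lin_span0.
apply: ideal_spanD Iq; have [gu ->] := uP i; rewrite -mulr_algl.
apply: ideal_spanM; have [gc sc] := canP i.
by apply: fibre_connected; rewrite ?sc.
Qed.

End Connected.
End Presentation.

Theorem theorem2p2 (R : realType) (r k : nat) (hr : (0 < r)%N) (hk : (0 < k)%N)
    (w : 'M[int]_(k, r)) (d0 : nat) (hd0 : (0 < d0)%N)
    (hgen : forall n : nat, (0 < n)%N -> generated_upto R[i] w n d0) :
  exists d1 : nat, (0 < d1)%N /\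
    forall n : nat, (0 < n)%N ->
      exists G : pres_alg R[i] w n d0 -> Prop,
        (forall g, G g -> exists e : nat, (e <= d1)%N /\ multihomog e g) /\
        (forall p, pres_ideal p <-> ideal_span G p).
Proof.
(* Above this degree m - g has degree more than d0 * 2 ^ (box_card w).+1, so it
   has more than 2 ^ (box_card w).+1 factors of positive degree. *)
exists (d0 * (2 ^ (box_card w).+1).+1)%N; split; first by rewrite muln_gt0 hd0.
move=> n n0; exists (low_relation (d0 * (2 ^ (box_card w).+1).+1)).
split=> [g []//|p].
exact: (kernel_spanned (Ordinal n0) (hgen n n0)).
Qed.
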